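(* Let $\mathbb{F}=\mathbb{R}$ or $\mathbb{F}=\mathbb{C}$, let $n,m,p,q\in\mathbb{N}^*$, $d\in\mathbb{N}$, and for $(i,j)\in\{1,\dots,p\}\times\{1,\dots,q\}$ let $n_{i,j},m_{i,j}\in\mathbb{N}^*$ and $g_{i,j}\in\mathbb{N}$ be such that $n_{i,j}=n_{i,k}$ for all $i,j,k$ and $\sum_{\alpha=1}^p n_{\alpha,k}=n$ for all $k$, and $m_{i,k}=m_{j,k}$ for all $i,j,k$ and $\sum_{\beta=1}^q m_{j,\beta}=m$ for all $j$. Let $$\mathfrak{F}:=\left(\mathbb{F}^{n_{1,1}\times m_{1,1}}\right)^{g_{1,1}+1}\times\cdots\times\left(\mathbb{F}^{n_{p,q}\times m_{p,q}}\right)^{g_{p,q}+1}.$$ The set $$S=\left\{P\in\mathfrak{F}\;\middle|\;\forall\,\lambda\in\mathbb{C}:\ \operatorname{rk}_{\mathbb{C}}\widehat{P}(\lambda)\geq d\right\}$$ is generic if, and only if, $$d\leq\min\{n,m\}\quad\wedge\quad\Big[\neg(d=n=m)\ \vee\ \big(\forall\,i\in\{1,\dots,p\}\ \forall\,j\in\{1,\dots,q\}:\ g_{i,j}=0\big)\Big].$$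
   Context: $\mathbb{N}=\{0,1,2,\dots\}$, $\mathbb{N}^*=\{1,2,\dots\}$. For $P=\big((P^{1,1}_0,\dots,P^{1,1}_{g_{1,1}}),\dots,(P^{p,q}_0,\dots,P^{p,q}_{g_{p,q}})\big)\in\mathfrak{F}$ put $P^{i,j}(x):=\sum_{k=0}^{g_{i,j}}P^{i,j}_kx^k\in\mathbb{F}[x]^{n_{i,j}\times m_{i,j}}$ and let $\widehat{P}(x)=[P^{i,j}(x)]_{i=1,\dots,p;\,j=1,\dots,q}\in\mathbb{F}[x]^{n\times m}$ be the resulting block matrix; $\widehat{P}(\lambda)\in\mathbb{C}^{n\times m}$ is its evaluation at $\lambda\in\mathbb{C}$. The space $\mathfrak{F}$ is identified with $\mathbb{F}^G$, $G=\sum_{i,j}n_{i,j}m_{i,j}(g_{i,j}+1)$, by listing all matrix entries. A set $\mathbb{V}\subseteq\mathbb{F}^G$ is an algebraic variety if it is the set of common zeros of finitely many polynomials in $\mathbb{F}[x_1,\dots,x_G]$; it is proper if $\mathbb{V}\neq\mathbb{F}^G$. A set $S\subseteq\mathbb{F}^G$ is generic if its complement is contained in some proper algebraic variety. *)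

(* Defs.v *)
From HB Require Import structures.
From mathcomp Require Import all_boot all_order all_algebra.
From mathcomp Require Import mpoly.
From mathcomp Require Import reals complex.

Set Implicit Arguments.
Unset Strict Implicit.
Unset Printing Implicit Defensive.

Import GRing.Theory.
Local Open Scope ring_scope.

Section Genericity.
Variables (F : fieldType) (G : nat).
Implicit Types V S : 'rV[F]_G -> Prop.

Definition algebraic_variety V :=
  exists fs : seq {mpoly F[G]},
    forall x, V x <-> (forall f, f \in fs -> f.@[fun t => x 0 t] = 0).

Definition is_proper V := ~ (forall x, V x).

Definition generic S :=
  exists V, [/\ algebraic_variety V, is_proper V & forall x, ~ S x -> V x].

End Genericity.

Section BlockPolynomials.
Variables (F : fieldType) (p q : nat).
Variables (nb mb g : 'I_p -> 'I_q -> nat).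

(* P i j k is the coefficient of x^k in the (i, j) block. *)
Definition coef_space :=
  forall (i : 'I_p) (j : 'I_q), 'I_(g i j).+1 -> 'M[F]_(nb i j, mb i j).

(* A scalar coordinate of coef_space: block (i, j), then the degree k,
   the row and the column of the entry in the coefficient. *)
Definition entry : finType :=
  {i : 'I_p & {j : 'I_q & ('I_(g i j).+1 * 'I_(nb i j) * 'I_(mb i j))%type}}.

Definition ncoord : nat := #|entry|.

Lemma ncoordE :
  ncoord = (\sum_(i < p) \sum_(j < q) nb i j * mb i j * (g i j).+1)%N.
Proof.
rewrite /ncoord card_tagged sumnE big_map big_enum; apply: eq_bigr => i _.
rewrite card_tagged sumnE big_map big_enum; apply: eq_bigr => j _.
by rewrite !card_prod !card_ord -mulnA mulnC.
Qed.

Definition coef_at (P : coef_space) (e : entry) : F :=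
  let: existT i (existT j (k, a, b)) := e in P i j k a b.

Definition listing (P : coef_space) : 'rV[F]_ncoord :=
  \row_t coef_at P (enum_val t).

Definition unlisting (x : 'rV[F]_ncoord) : coef_space :=
  fun i j k => \matrix_(a, b)
    x 0 (enum_rank (existT _ i (existT _ j (k, a, b)) : entry)).

Lemma unlistingK : cancel unlisting listing.
Proof.
move=> x; apply/rowP => t; rewrite mxE -[in RHS](enum_valK t).
by case: (enum_val t) => i [j [[k a] b]]; rewrite /= mxE.
Qed.

Lemma listingK : cancel listing unlisting.
Proof.
move=> P; do 3!(apply: boolp.functional_extensionality_dep => ?).
by apply/matrixP => a b; rewrite !mxE enum_rankK.
Qed.

Definition generic_coef (S : coef_space -> Prop) :=
  generic (fun x => exists P, S P /\ listing P = x).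

Definition block_poly (P : coef_space) (i : 'I_p) (j : 'I_q) :
    'M[{poly F}]_(nb i j, mb i j) :=
  \sum_(k < (g i j).+1) 'X^k *: map_mx polyC (P i j k).

Section Assembly.
Variables (n m : nat) (hp : (0 < p)%N) (hq : (0 < q)%N).
Hypothesis hn : forall i j k, nb i j = nb i k.
Hypothesis hsn : forall k, (\sum_i nb i k)%N = n.
Hypothesis hm : forall i j k, mb i k = mb j k.
Hypothesis hsm : forall j, (\sum_k mb j k)%N = m.

(* The heights of the block rows are read off the first block column, and the
   widths of the block columns off the first block row; every block is cast to
   the resulting format along hn and hm. *)
Definition block_mat (P : coef_space) : 'M[{poly F}]_(n, m) :=
  let i0 := Ordinal hp in
  let j0 := Ordinal hq in
  castmx (hsn j0, hsm i0)
    (\mxblock_(i, j) castmx (hn i j j0, hm i i0 j) (block_poly P i j)).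

End Assembly.

End BlockPolynomials.

(* Evaluation of a matrix over F[x] at a point of an extension field C of F,
   with embedding iota. *)
Definition eval_mx (F C : fieldType) (iota : {rmorphism F -> C}) (n m : nat)
    (A : 'M[{poly F}]_(n, m)) (z : C) : 'M[C]_(n, m) :=
  map_mx (fun f => (map_poly iota f).[z]) A.

(* Main.v *)
Require Import Defs.
From mathcomp Require Import all_boot all_order all_fingroup all_algebra.
From mathcomp Require Import mpoly.
From mathcomp Require Import reals complex.

Set Implicit Arguments.
Unset Strict Implicit.
Unset Printing Implicit Defensive.

Import GRing.Theory Num.Theory.
Local Open Scope ring_scope.

(* A set is generic iff it contains the nonvanishing locus of a nonzero
   polynomial, and over an infinite field two such loci meet.
   If d = n = m and some g(i, j) is positive, then det P(x) has, for some P, a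
   nonzero coefficient at x; hence det P(x) is generically nonconstant and so
   has a complex root.
   If d < m, consider the minors of the first d rows on columns 1..d and on
   columns 2..d+1: their Sylvester determinant, padded to the largest degree the
   first minor can have, is a polynomial in the coefficients of P whose
   nonvanishing excludes a common root.  It does not vanish identically:
   writing s for a permutation maximizing the sum of the g(i, s i), the matrix
   with x^g(i, s i) at (i, s i) and 1 at (i, s i + 1) has first minor a signed
   monomial of that largest degree and second minor a sign.  The case d < n
   follows by transposition. *)

(** * Polynomial functions on the coordinate space and genericity *)

Section PolynomialFunctions.
Variables (F : numFieldType) (G : nat).
Implicit Types (f : 'rV[F]_G -> F) (x : 'rV[F]_G).

(** Genericity depends only on values, so the polynomial stays hidden behind an existential and
    closure properties are proved pointwise. *)
Definition polyfun f :=
  exists p : {mpoly F[G]}, forall x, f x = p.@[fun t => x 0 t].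

Lemma polyfun_ext f1 f2 : f1 =1 f2 -> polyfun f1 -> polyfun f2.
Proof. by move=> e [p hp]; exists p => x; rewrite -e hp. Qed.

Lemma polyfun_const c : polyfun (fun=> c).
Proof. by exists c%:MP => x; rewrite mevalC. Qed.

Lemma polyfun_coord t : polyfun (fun x => x 0 t).
Proof. by exists 'X_t => x; rewrite mevalXU. Qed.

Lemma polyfunD f1 f2 :
  polyfun f1 -> polyfun f2 -> polyfun (fun x => f1 x + f2 x).
Proof. by move=> [p hp] [q hq]; exists (p + q) => x; rewrite mevalD hp hq. Qed.

Lemma polyfunM f1 f2 :
  polyfun f1 -> polyfun f2 -> polyfun (fun x => f1 x * f2 x).
Proof. by move=> [p hp] [q hq]; exists (p * q) => x; rewrite mevalM hp hq. Qed.

Lemma polyfun_sum (I : Type) (r : seq I) (P : pred I) (f : I -> 'rV[F]_G -> F) :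
  (forall i, polyfun (f i)) -> polyfun (fun x => \sum_(i <- r | P i) f i x).
Proof.
move=> hf; elim: r => [|i r IH].
  by apply: polyfun_ext (polyfun_const 0) => x; rewrite big_nil.
case Pi: (P i); last by apply: polyfun_ext IH => x; rewrite big_cons Pi.
by apply: polyfun_ext (polyfunD (hf i) IH) => x; rewrite big_cons Pi.
Qed.

Lemma polyfun_det k (A : 'rV[F]_G -> 'M[F]_k) :
  (forall i j, polyfun (fun x => A x i j)) -> polyfun (fun x => \det (A x)).
Proof.
move=> hA; apply: polyfun_sum => s; apply: polyfunM; first exact: polyfun_const.
elim: (index_enum _) => [|i r IH].
  by apply: polyfun_ext (polyfun_const 1) => x; rewrite big_nil.
by apply: polyfun_ext (polyfunM (hA i (s i)) IH) => x; rewrite big_cons.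
Qed.

Lemma polyfun_coefM (f1 f2 : 'rV[F]_G -> {poly F}) :
  (forall k, polyfun (fun x => (f1 x)`_k)) ->
  (forall k, polyfun (fun x => (f2 x)`_k)) ->
  forall k, polyfun (fun x => (f1 x * f2 x)`_k).
Proof.
move=> h1 h2 k.
have: polyfun (fun x => \sum_(j < k.+1) (f1 x)`_j * (f2 x)`_(k - j)).
  by apply: polyfun_sum => j; apply: polyfunM.
by apply: polyfun_ext => x; rewrite coefM.
Qed.

Lemma polyfun_coef_det k (A : 'rV[F]_G -> 'M[{poly F}]_k) :
  (forall i j l, polyfun (fun x => (A x i j)`_l)) ->
  forall l, polyfun (fun x => (\det (A x))`_l).
Proof.
move=> hA l.
have: polyfun (fun x => \sum_(s : 'S_k)
    ((-1) ^+ s * \prod_i A x i (s i))`_l).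
  apply: polyfun_sum => s; apply: polyfun_coefM => {}l.
    exact: polyfun_const.
  elim: (index_enum _) l => [|i r IH] l.
    by apply: polyfun_ext (polyfun_const (1 : {poly F})`_l) => x; rewrite big_nil.
  by apply: polyfun_ext (polyfun_coefM (hA i (s i)) IH l) => x; rewrite big_cons.
by apply: polyfun_ext => x; rewrite coef_sum.
Qed.

Lemma polyfun_line f x0 v :
  polyfun f -> exists p : {poly F}, forall t, f (x0 + t *: v) = p.[t].
Proof.
case=> p hp.
exists (\sum_(e <- msupp p) (p@_e)%:P *
          \prod_i ((x0 0 i)%:P + (v 0 i)%:P * 'X) ^+ e i) => t.
rewrite hp mevalE horner_sum; apply: eq_bigr => e _.
rewrite hornerM hornerC horner_prod; congr (_ * _); apply: eq_bigr => i _.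
by rewrite !hornerE !mxE mulrC.
Qed.

(** In characteristic zero the first [size p] natural numbers are distinct, hence too many roots for
    a nonzero [p]. *)
Lemma num_poly_eq0 (p : {poly F}) : (forall t, p.[t] = 0) -> p = 0.
Proof.
move=> hp; apply/eqP; case: eqP => // /eqP p0.
have := @max_poly_roots F p [seq i%:R | i <- iota 0 (size p)] p0.
rewrite size_map size_iota ltnn => -> //.
  by apply/allP => x _; apply/eqP/hp.
by rewrite map_inj_uniq ?iota_uniq // => i j /eqP; rewrite eqr_nat => /eqP.
Qed.

(* Restricting to the line through x1 and x2 reduces this to one variable. *)
Lemma polyfun_common_neq0 f1 f2 x1 x2 :
  polyfun f1 -> polyfun f2 -> f1 x1 != 0 -> f2 x2 != 0 ->
  exists x, f1 x != 0 /\ f2 x != 0.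
Proof.
move=> /(polyfun_line x1 (x2 - x1)) [p hp] /(polyfun_line x1 (x2 - x1)) [q hq].
move=> n1 n2; have p0 : p != 0.
  apply: contra n1 => /eqP e; have := hp 0.
  by rewrite e horner0 scale0r addr0 => ->.
have q0 : q != 0.
  apply: contra n2 => /eqP e; have := hq 1.
  by rewrite e horner0 scale1r addrC subrK => ->.
have [t ht] : exists t, (p * q).[t] != 0.
  apply: boolp.contrapT => hn; have /eqP : p * q = 0.
    apply: num_poly_eq0 => t; apply/eqP; apply: boolp.contrapT => /negP ht.
    by apply: hn; exists t.
  by rewrite mulf_eq0 (negbTE p0) (negbTE q0).
move: ht; rewrite hornerM mulf_eq0 negb_or => /andP[ht1 ht2].
by exists (x1 + t *: (x2 - x1)); rewrite hp hq.
Qed.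

Lemma generic_ext (S1 S2 : 'rV[F]_G -> Prop) :
  (forall x, S1 x <-> S2 x) -> generic S1 <-> generic S2.
Proof.
move=> e; split=> -[V [vV pV hV]]; exists V; split=> // x nS;
  by apply: hV => /e.
Qed.

(** Some defining equation of a proper variety is not identically zero, and its zero set still
    contains the complement of [S]. *)
Lemma genericP (S : 'rV[F]_G -> Prop) :
  generic S <->
  exists f, [/\ polyfun f, exists x, f x != 0 & forall x, f x != 0 -> S x].
Proof.
split=> [[V [[fs hV] hprop hS]]|[f [[p hp] [x0 hx0] hS]]].
  apply: boolp.contrapT => hn; apply: hprop => x; apply/hV => p hp.
  apply/eqP; apply: boolp.contrapT => /negP px.
  apply: hn; exists (fun y => p.@[fun t => y 0 t]); split.
  - by exists p.
  - by exists x.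
  move=> y py; apply: boolp.contrapT => /hS /hV /(_ p hp) e.
  by rewrite e eqxx in py.
exists (fun x => f x = 0); split.
- exists [:: p] => x; rewrite hp; split=> [e q|]; last by apply; rewrite inE.
  by rewrite inE => /eqP ->.
- by move=> /(_ x0) e; rewrite e eqxx in hx0.
move=> x nS; apply/eqP; apply: boolp.contrapT => /negP fx.
exact: nS (hS _ fx).
Qed.

End PolynomialFunctions.

(** * Ranks, degrees of determinants and Sylvester matrices *)

Section Minors.

Lemma mxrank_mxsub (K : fieldType) n m k l (r : 'I_k -> 'I_n) (c : 'I_l -> 'I_m)
  (A : 'M[K]_(n, m)) : (\rank (mxsub r c A) <= \rank A)%N.
Proof.
have -> : mxsub r c A = rowsub r (colsub c A).
  by apply/matrixP => i j; rewrite !mxE.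
apply: leq_trans (mxrankS (rowsub_sub _ _)) _.
have -> : colsub c A = (rowsub c A^T)^T by apply/matrixP => i j; rewrite !mxE.
by rewrite mxrank_tr -[leqRHS]mxrank_tr; apply/mxrankS/rowsub_sub.
Qed.

Lemma size_prod_leq (K : idomainType) (I : Type) (r : seq I) (f : I -> {poly K})
    (h : I -> nat) :
  (forall i, size (f i) <= (h i).+1)%N ->
  (size (\prod_(i <- r) f i)%R <= (\sum_(i <- r) h i).+1)%N.
Proof.
move=> hf; elim: r => [|i r IH]; first by rewrite !big_nil size_poly1.
rewrite !big_cons; apply: leq_trans (size_polyMleq _ _) _.
rewrite -subn1 leq_subLR; apply: leq_trans (leq_add (hf i) IH) _.
by rewrite addSn addnS.
Qed.

Lemma size_det_leq (K : idomainType) n (A : 'M[{poly K}]_n)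
    (h : 'I_n -> 'I_n -> nat) D :
  (forall i j, size (A i j) <= (h i j).+1)%N ->
  (forall s : 'S_n, \sum_i h i (s i) <= D)%N ->
  (size (\det A)%R <= D.+1)%N.
Proof.
move=> hA hD; apply: leq_trans (size_sum _ _ _) _; apply/bigmax_leqP => s _.
rewrite -signr_odd mulr_sign; set p := \prod_i _.
have hp : (size p <= D.+1)%N.
  apply: (leq_trans (@size_prod_leq _ _ _ _ (fun i => h i (s i)) _)) => //.
  by rewrite ltnS.
by case: odd => //; rewrite size_polyN.
Qed.

(* The Sylvester matrix of p and q, padded to formal degrees b and a. *)
Definition sylv (K : fieldType) a b (p q : {poly K}) : 'M[K]_(a + b) :=
  col_mx (\matrix_(i < a, j < a + b) ('X^i * p)`_j)
         (\matrix_(i < b, j < a + b) ('X^i * q)`_j).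

(** The vector of powers of [z] lies in the kernel: each row holds the coefficients of a shifted [p]
    or [q], of degree below [a + b], so its product with that vector is a value at [z]. With [0 < a]
    the vector has the coordinate 1 and is nonzero. *)
Lemma sylv_common_root (K L : fieldType) (iota : {rmorphism K -> L}) a b
    (p q : {poly K}) z :
  (0 < a)%N -> (size p <= b.+1)%N -> (size q <= a.+1)%N ->
  root (map_poly iota p) z -> root (map_poly iota q) z ->
  \det (sylv a b p q) = 0.
Proof.
move=> a0 sp sq rp rq.
have aux k (u : {poly K}) c i : (i < k)%N -> (size u <= c.+1)%N ->
    (k + c = a + b)%N -> root (map_poly iota u) z ->
    \sum_(j < a + b) iota ('X^i * u)`_j * z ^+ j = 0.
  move=> ik su e /eqP ru.
  have sz : (size (map_poly iota ('X^i * u)) <= a + b)%N.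
    rewrite size_map_poly; apply: leq_trans (size_polyMleq _ _) _.
    rewrite size_polyXn /= -e; apply: leq_trans (leq_add (leqnn _) su) _.
    by rewrite addnS -addSn leq_add2r.
  transitivity (map_poly iota ('X^i * u)).[z].
    rewrite (horner_coef_wide z sz); apply: eq_bigr => j _.
    by rewrite coef_map.
  by rewrite rmorphM hornerM ru mulr0.
apply/eqP; rewrite -(fmorph_eq0 iota) -det_map_mx -det_tr.
apply/det0P; exists (\row_j z ^+ j).
  apply/eqP => /rowP /(_ (lshift b (Ordinal a0))) /eqP.
  by rewrite !mxE expr0 oner_eq0.
apply/rowP => i; rewrite !mxE.
transitivity (\sum_j iota (sylv a b p q i j) * z ^+ j).
  by apply: eq_bigr => j _; rewrite !mxE mulrC.
rewrite -(splitK i); case: (split i) => {}i /=.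
  under eq_bigr do rewrite col_mxEu mxE.
  exact: (aux a _ b).
under eq_bigr do rewrite col_mxEd mxE.
by apply: (aux b _ a); rewrite // addnC.
Qed.

(** Each row has a single nonzero entry. The lower rows meet the columns below [b] and the upper
    rows the remaining ones, so every coordinate of a kernel vector is forced to vanish. *)
Lemma det_sylv_monomial (K : fieldType) a b (c e : K) :
  c != 0 -> e != 0 -> \det (sylv a b (c *: 'X^b) e%:P) != 0.
Proof.
move=> c0 e0; rewrite -det_tr; apply/det0P => -[v /eqP v0 hv]; apply: v0.
have ent i : \sum_j v 0 j * sylv a b (c *: 'X^b) e%:P i j = 0.
  move/rowP/(_ i): hv; rewrite !mxE => h; rewrite -[RHS]h.
  by apply: eq_bigr => j _; rewrite !mxE.
have hv1 k (hk : (k < a + b)%N) u (w : K) i : w != 0 ->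
    (forall j, sylv a b (c *: 'X^b) e%:P i j = w *+ (j == u :> nat)) ->
    u = k -> v 0 (Ordinal hk) = 0.
  move=> w0 hw eu; have := ent i.
  rewrite (bigD1 (Ordinal hk)) //= hw eu eqxx big1 ?addr0 => [|j].
    by move/eqP; rewrite mulf_eq0 (negbTE w0) orbF => /eqP.
  by rewrite -val_eqE /= => /negbTE jk; rewrite hw eu jk mulr0.
apply/rowP => -[k hk]; rewrite mxE; case: (ltnP k b) => kb.
  apply: (hv1 k hk k e (rshift a (Ordinal kb))) => // j.
  by rewrite /sylv col_mxEd mxE coefMC coefXn mulr_natl.
have kb' : (k - b < a)%N by rewrite ltn_subLR // addnC.
apply: (hv1 k hk k c (lshift b (Ordinal kb'))) => // j.
by rewrite /sylv col_mxEu mxE -scalerAr -exprD coefZ coefXn subnK // mulr_natr.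
Qed.

Lemma det_row_perm (K : comPzRingType) k (s : 'S_k) (A : 'M[K]_k) :
  \det A = (-1) ^+ s * \det (row_perm s A).
Proof. by rewrite row_permE det_mulmx det_perm mulrA -expr2 sqrr_sign mul1r. Qed.

End Minors.

(** * Generic rank of polynomial matrices with prescribed degree bounds *)

Section FullFamilies.
Variables (F : numFieldType) (G : nat).

(** This keeps from block matrices only what the rank arguments use, in a form stable under
    transposition and passage to submatrices. *)
Definition full_family n m (h : 'I_n -> 'I_m -> nat)
    (B : 'rV[F]_G -> 'M[{poly F}]_(n, m)) :=
  [/\ forall a b k, polyfun (fun x => (B x a b)`_k),
      forall x a b, (size (B x a b) <= (h a b).+1)%N &
      forall M : 'M[{poly F}]_(n, m),
        (forall a b, size (M a b) <= (h a b).+1)%N -> exists x, B x = M].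

Lemma full_family_tr n m h (B : 'rV[F]_G -> 'M[{poly F}]_(n, m)) :
  full_family h B -> full_family (fun b a => h a b) (fun x => (B x)^T).
Proof.
case=> h1 h2 h3; split=> [a b k|x a b|M hM].
- by apply: polyfun_ext (h1 b a k) => x; rewrite mxE.
- by rewrite mxE.
have [|x hx] := h3 M^T; first by move=> a b; rewrite mxE.
by exists x; rewrite hx trmxK.
Qed.

Lemma full_family_sub n m k l h (B : 'rV[F]_G -> 'M[{poly F}]_(n, m))
    (r : 'I_k -> 'I_n) (c : 'I_l -> 'I_m) :
  injective r -> injective c -> full_family h B ->
  full_family (fun i j => h (r i) (c j)) (fun x => mxsub r c (B x)).
Proof.
move=> rI cI [h1 h2 h3]; split=> [i j u|x i j|M hM].
- by apply: polyfun_ext (h1 (r i) (c j) u) => x; rewrite mxE.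
- by rewrite mxE.
(* A prescribed submatrix is extended by zero outside the selected rows and columns. *)
have [|x hx] := h3 (\matrix_(a, b)
    if [pick i | r i == a] is Some i then
      if [pick j | c j == b] is Some j then M i j else 0
    else 0).
  move=> a b; rewrite mxE; case: pickP => [i /eqP <-|_];
    last by rewrite size_poly0.
  by case: pickP => [j /eqP <-|_]; rewrite ?size_poly0.
exists x; rewrite hx; apply/matrixP => i j; rewrite !mxE.
case: pickP => [i' /eqP/rI ->|/(_ i)]; last by rewrite eqxx.
by case: pickP => [j' /eqP/cI ->|/(_ j)]; last by rewrite eqxx.
Qed.

(** The polynomial [f] is chosen before [C], so one choice serves all extension fields. *)
Lemma full_family_coprime_minors d (h : 'I_d -> 'I_d.+1 -> nat) B :
  full_family h B ->
  exists f : 'rV[F]_G -> F, [/\ polyfun f, exists x, f x != 0 &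
    forall (C : fieldType) (iota : {rmorphism F -> C}) x z, f x != 0 ->
      \rank (eval_mx iota (B x) z) = d].
Proof.
case=> hcoef hsize hsurj.
pose lo := colsub (widen_ord (leqnSn d)) : 'M_(d, d.+1) -> 'M[{poly F}]_d.
pose hi := colsub (lift ord0) : 'M_(d, d.+1) -> 'M[{poly F}]_d.
pose w (s : 'S_d) := (\sum_i h i (widen_ord (leqnSn d) (s i)))%N.
have [s _ smax] := @arg_maxnP _ (1%g : 'S_d) xpredT w isT.
(* Only the bound [w s] on the first minor must be sharp; for the second a crude one suffices. The
   successor makes [D] positive, as [sylv_common_root] demands. *)
pose D := (\sum_i \sum_j h i (lift ord0 j)).+1%N.
have sizelo x : (size (\det (lo (B x))) <= (w s).+1)%N.
  apply: (@size_det_leq _ _ _ (fun i j => h i (widen_ord (leqnSn d) j))) => [i j|u].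
    by rewrite mxE.
  exact: smax.
have sizehi x : (size (\det (hi (B x))) <= D.+1)%N.
  apply: (@size_det_leq _ _ _ (fun i j => h i (lift ord0 j))) => [i j|u].
    by rewrite mxE.
  apply/leqW/leq_sum => i _.
  by rewrite (bigD1 (u i)) //= leq_addr.
exists (fun x => \det (sylv D (w s) (\det (lo (B x))) (\det (hi (B x))))); split.
- apply: polyfun_det => i j; rewrite -(splitK i); case: (split i) => {}i /=.
    apply: (@polyfun_ext _ _ (fun x => ('X^i * \det (lo (B x)))`_j)) => [x|].
      by rewrite /sylv col_mxEu mxE.
    apply: polyfun_coefM => k; first exact: polyfun_const.
    apply: polyfun_coef_det => a b l.
    by apply: polyfun_ext (hcoef _ _ l) => x; rewrite mxE.
  apply: (@polyfun_ext _ _ (fun x => ('X^i * \det (hi (B x)))`_j)) => [x|].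
    by rewrite /sylv col_mxEd mxE.
  apply: polyfun_coefM => k; first exact: polyfun_const.
  apply: polyfun_coef_det => a b l.
  by apply: polyfun_ext (hcoef _ _ l) => x; rewrite mxE.
(* Permuting the rows by the inverse of [s] makes the first minor upper triangular with the
   monomials on its diagonal, and the second lower triangular with ones there. *)
- pose Q : 'M[{poly F}]_(d, d.+1) := \matrix_(i, j)
    if j == s i :> nat then 'X^(h i j) else (j == (s i).+1 :> nat)%:R.
  have [|x hx] := hsurj Q.
    move=> i j; rewrite mxE; case: ifP => _; first by rewrite size_polyXn.
    by case: eqP; rewrite ?size_poly1 ?size_poly0.
  have dlo : \det (lo Q) = (-1) ^+ s *: 'X^(w s).
    rewrite (det_row_perm s^-1%g) odd_permV -det_tr det_trig.
      transitivity ((-1) ^+ s * \prod_i 'X^(h (s^-1%g i) (widen_ord (leqnSn d) i)) :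
          {poly F}).
        by congr (_ * _); apply: eq_bigr => i _; rewrite !mxE permKV eqxx.
      rewrite (reindex_inj (@perm_inj _ s)) /=.
      under eq_bigr do rewrite permK.
      by rewrite prodrXr -mul_polyC rmorph_sign.
    apply/is_trig_mxP => i j ij; rewrite !mxE permKV /=.
    by rewrite !ltn_eqF // ltnW.
  have dhi : \det (hi Q) = ((-1) ^+ s)%:P.
    rewrite (det_row_perm s^-1%g) odd_permV det_trig.
      rewrite big1 ?mulr1 ?rmorph_sign // => i _.
      by rewrite !mxE permKV lift0 eqxx gtn_eqF.
    apply/is_trig_mxP => i j ij; rewrite !mxE permKV lift0 eqSS.
    by rewrite !gtn_eqF // ltnW.
  exists x; rewrite hx dlo dhi det_sylv_monomial // signr_eq0 //.
move=> C iota x z; apply: contraNeq => rk.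
(* If the rank drops at [z], every maximal minor vanishes there; in particular the two chosen minors
   share the root [z]. *)
have rkd (c : 'I_d -> 'I_d.+1) : root (map_poly iota (\det (colsub c (B x)))) z.
  apply: contraR rk => nr.
  have u : colsub c (eval_mx iota (B x) z) \in unitmx.
    rewrite unitmxE unitfE; apply: contra nr => /eqP e; apply/eqP.
    rewrite -det_map_mx -horner_evalE -det_map_mx -[RHS]e.
    by congr (\det _); apply/matrixP => i j; rewrite !mxE.
  rewrite eqn_leq rank_leq_row -{1}(mxrank_unit u).
  exact: (mxrank_mxsub id).
by apply/eqP; apply: (@sylv_common_root _ C iota _ _ _ _ z); rewrite ?rkd.
Qed.

(** The first [d] rows and [d.+1] columns again form a full family, and generically this submatrix
    already has rank [d] everywhere. *)
Lemma full_family_generic_rank n m d h (B : 'rV[F]_G -> 'M[{poly F}]_(n, m))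
    (C : fieldType) (iota : {rmorphism F -> C}) :
  full_family h B -> (d <= n)%N -> (d < m)%N ->
  generic (fun x => forall z, (d <= \rank (eval_mx iota (B x) z))%N).
Proof.
move=> hB dn dm; have wI k l (le_kl : (k <= l)%N) : injective (widen_ord le_kl).
  by move=> i j /(congr1 val) /= ?; apply: val_inj.
have [f [pf f0 hf]] := full_family_coprime_minors
  (full_family_sub (wI _ _ dn) (wI _ _ dm) hB).
apply/genericP; exists f; split=> // x fx z.
rewrite -{1}(hf C iota x z fx); set A := eval_mx _ _ _.
have -> : A = mxsub (widen_ord dn) (widen_ord dm) (eval_mx iota (B x) z).
  by apply/matrixP => i j; rewrite !mxE.
exact: mxrank_mxsub.
Qed.

Lemma full_family_genericP n m d h (B : 'rV[F]_G -> 'M[{poly F}]_(n, m))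
    (C : closedFieldType) (iota : {rmorphism F -> C}) :
  full_family h B ->
  generic (fun x => forall z, (d <= \rank (eval_mx iota (B x) z))%N) <->
  (d <= minn n m)%N /\ (~ (d = n /\ n = m) \/ forall a b, h a b = 0%N).
Proof.
move=> hB; have [hcoef hsize hsurj] := hB; split.
  move=> /genericP [f [pf [x0 fx0] hf]]; split.
    rewrite leq_min (leq_trans (hf _ fx0 0) (rank_leq_row _)).
    exact: leq_trans (hf _ fx0 0) (rank_leq_col _).
  apply: boolp.contrapT => /boolp.not_orP [/boolp.contrapT [? ?]].
  move=> /boolp.existsNP [a /boolp.existsNP [b /eqP hab]]; subst.
  (* The permutation matrix swapping [a] and [b], with row [a] scaled by ['X], respects the degree
     bounds because its only nonconstant entry is at [(a, b)]. Its determinant is ['X] up to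
     sign. *)
  pose s := tperm a b.
  pose D : 'rV[{poly F}]_m := \row_i if i == a then 'X else 1.
  have [|x1 hx1] := hsurj (diag_mx D *m perm_mx s).
    move=> i j; rewrite mul_diag_mx !mxE.
    case: (altP (s i =P j)) => [<-|_]; last by rewrite mulr0 size_poly0.
    rewrite mulr1; case: eqP => [->|_]; last by rewrite size_poly1.
    by rewrite tpermL size_polyX ltnS lt0n.
  have c1 : (\det (B x1))`_1 != 0.
    rewrite hx1 det_mulmx det_diag det_perm (bigD1 a) //= big1 => [|i ia].
      rewrite mxE eqxx mulr1 -signr_odd mulrC mulr_sign.
      by case: odd; rewrite ?coefN coefX ?oppr_eq0 oner_eq0.
    by rewrite mxE (negbTE ia).
  have [|x [fx /eqP []]] :=
      @polyfun_common_neq0 _ _ f (fun x => (\det (B x))`_1) _ _ pf _ fx0 c1.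
    by apply: polyfun_coef_det => i j l; apply: hcoef.
  (* Full rank at every [z] leaves the determinant without roots, so over a closed field it is a
     nonzero constant, against its coefficient at degree 1. *)
  have : size (map_poly iota (\det (B x))) == 1%N.
    apply: contraT => /closed_rootP [z /eqP rz].
    have := hf x fx z; rewrite -ltnS => hr.
    have : row_free (eval_mx iota (B x) z).
      by rewrite /row_free eqn_leq rank_leq_row.
    rewrite row_free_unit unitmxE unitfE => /eqP []; rewrite -[RHS]rz.
    rewrite -det_map_mx -horner_evalE -det_map_mx.
    by congr (\det _); apply/matrixP => i j; rewrite !mxE.
  by rewrite size_map_poly => /eqP e; rewrite nth_default ?e.
rewrite leq_min => -[/andP[dn dm] alt].
have [dm'|md] := ltnP d m; first exact: full_family_generic_rank hB dn dm'.
have [dn'|nd] := ltnP d n.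
  apply/generic_ext; last first.
    exact: (full_family_generic_rank iota (full_family_tr hB) dm dn').
  move=> x; split=> hr z; have := hr z; rewrite -mxrank_tr;
    congr (is_true (_ <= \rank _)%N); by apply/matrixP => i j; rewrite !mxE.
have dnE : d = n by apply/eqP; rewrite eqn_leq dn.
have dmE : d = m by apply/eqP; rewrite eqn_leq dm.
have h0 : forall a b, h a b = 0%N by case: alt => // -[]; rewrite -dmE -dnE.
clear alt dn dm md nd; subst n; subst m.
(* Here all entries are constant, so the determinant is its own constant coefficient and the
   evaluated matrix does not depend on [z]. *)
apply/genericP; exists (fun x => (\det (B x))`_0); split.
- by apply: polyfun_coef_det => i j l; apply: hcoef.
- have [|x hx] := hsurj 1%:M.
    by move=> i j; rewrite mxE h0; case: eqP; rewrite ?size_poly1 ?size_poly0.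
  by exists x; rewrite hx det1 coefC oner_eq0.
move=> x fx z.
have -> : eval_mx iota (B x) z =
    map_mx (fun p : {poly F} => iota p`_0) (B x).
  apply/matrixP => i j; rewrite !mxE (size1_polyC (p := B x i j)).
    by rewrite map_polyC hornerC coefC.
  by rewrite -(h0 i j).
rewrite mxrank_unit // unitmxE unitfE.
have -> : map_mx (fun p : {poly F} => iota p`_0) (B x) =
    map_mx iota (map_mx (horner_eval 0) (B x)).
  by apply/matrixP => i j; rewrite !mxE /horner_eval horner_coef0.
by rewrite !det_map_mx fmorph_eq0 /= /horner_eval horner_coef0.
Qed.

End FullFamilies.

(** * Block matrices as full families, and the final equivalence *)

Section BlockFamily.
Variables (F : numFieldType) (n m p q : nat) (hp : (0 < p)%N) (hq : (0 < q)%N).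
Variables (nb mb g : 'I_p -> 'I_q -> nat).
Hypothesis hn : forall i j k, nb i j = nb i k.
Hypothesis hsn : forall k, (\sum_i nb i k)%N = n.
Hypothesis hm : forall i j k, mb i k = mb j k.
Hypothesis hsm : forall j, (\sum_k mb j k)%N = m.

Let i0 := Ordinal hp.
Let j0 := Ordinal hq.
Let row_idx (a : 'I_n) := cast_ord (esym (hsn j0)) a.
Let col_idx (b : 'I_m) := cast_ord (esym (hsm i0)) b.

Definition block_deg (a : 'I_n) (b : 'I_m) :=
  g (tagnat.sig1 (row_idx a)) (tagnat.sig1 (col_idx b)).

Lemma block_polyE (P : coef_space F nb mb g) i j a b :
  block_poly P i j a b = \sum_(k < (g i j).+1) P i j k a b *: 'X^k.
Proof.
rewrite summxE; apply: eq_bigr => k _; rewrite !mxE.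
by rewrite mulrC mul_polyC.
Qed.

Lemma coef_block_poly (P : coef_space F nb mb g) i j a b l :
  (block_poly P i j a b)`_l = \sum_(k < (g i j).+1 | l == k) P i j k a b.
Proof.
rewrite block_polyE coef_sum [RHS]big_mkcond; apply: eq_bigr => k _ /=.
by rewrite coefZ coefXn; case: eqP; rewrite ?mulr1 ?mulr0.
Qed.

Lemma size_block_poly (P : coef_space F nb mb g) i j a b :
  (size (block_poly P i j a b) <= (g i j).+1)%N.
Proof.
apply/leq_sizeP => l hl; rewrite coef_block_poly big_pred0 // => k.
by rewrite gtn_eqF // (leq_trans (ltn_ord k)).
Qed.

Lemma block_matE (P : coef_space F nb mb g) a b :
  let i := tagnat.sig1 (row_idx a) in let j := tagnat.sig1 (col_idx b) in
  block_mat hp hq hn hsn hm hsm P a b =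
  block_poly P i j (cast_ord (esym (hn i j j0)) (tagnat.sig2 (row_idx a)))
                   (cast_ord (esym (hm i i0 j)) (tagnat.sig2 (col_idx b))).
Proof. by rewrite /= /block_mat castmxE mxE castmxE. Qed.

Lemma block_mat_full_family :
  full_family block_deg
    (fun x => block_mat hp hq hn hsn hm hsm (@unlisting F p q nb mb g x)).
Proof.
split=> [a b l|x a b|M hM].
- set i := tagnat.sig1 (row_idx a); set j := tagnat.sig1 (col_idx b).
  set s := cast_ord (esym (hn i j j0)) (tagnat.sig2 (row_idx a)).
  set t := cast_ord (esym (hm i i0 j)) (tagnat.sig2 (col_idx b)).
  have : polyfun (fun x => \sum_(k < (g i j).+1 | l == k)
      @unlisting F p q nb mb g x i j k s t).
    apply: polyfun_sum => k; pose e : entry nb mb g :=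
      existT _ i (existT _ j (k, s, t)).
    by apply: polyfun_ext (polyfun_coord F (enum_rank e)) => x; rewrite mxE.
  by apply: polyfun_ext => x; rewrite block_matE coef_block_poly.
- by rewrite block_matE size_block_poly.
(* [ridx] and [cidx] send a position inside a block to its global position, so [P] reads its
   coefficients off the target matrix [M]. *)
pose ridx i j (s : 'I_(nb i j)) : 'I_n :=
  cast_ord (hsn j0) (tagnat.Rank i (cast_ord (hn i j j0) s)).
pose cidx i j (t : 'I_(mb i j)) : 'I_m :=
  cast_ord (hsm i0) (tagnat.Rank j (cast_ord (hm i i0 j) t)).
pose P : coef_space F nb mb g :=
  fun i j k => \matrix_(s, t) (M (ridx i j s) (cidx i j t))`_k.
exists (listing P); rewrite listingK; apply/matrixP => a b.
apply/polyP => l; rewrite block_matE coef_block_poly.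
under eq_bigr do rewrite mxE.
set r := ridx _ _ _; set c := cidx _ _ _.
have -> : r = a.
  by rewrite /r /ridx cast_ordKV tagnat.sig2K /row_idx cast_ordKV.
have -> : c = b.
  by rewrite /c /cidx cast_ordKV tagnat.sig2K /col_idx cast_ordKV.
have [hl|hl] := ltnP l (block_deg a b).+1.
  by rewrite (big_pred1 (Ordinal hl)) // => k; rewrite -val_eqE /= eq_sym.
rewrite big_pred0 => [|k]; last by rewrite gtn_eqF // (leq_trans (ltn_ord k)).
by rewrite nth_default // (leq_trans (hM a b)).
Qed.

(** Blocks are nonempty, so each bound [g i j] is attained as the bound of the first entry of its
    block. *)
Lemma block_deg_eq0 (hnb0 : forall i j, (0 < nb i j)%N)
    (hmb0 : forall i j, (0 < mb i j)%N) :
  (forall a b, block_deg a b = 0%N) <-> (forall i j, g i j = 0%N).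
Proof.
split=> [h i j|h a b]; last exact: h.
have := h (cast_ord (hsn j0) (tagnat.Rank i (Ordinal (hnb0 i j0))))
          (cast_ord (hsm i0) (tagnat.Rank j (Ordinal (hmb0 i0 j)))).
by rewrite /block_deg /row_idx /col_idx !cast_ordK !tagnat.Rank1K.
Qed.

Lemma generic_block_rankP d (C : closedFieldType) (iota : {rmorphism F -> C}) :
  (forall i j, (0 < nb i j)%N) -> (forall i j, (0 < mb i j)%N) ->
  generic_coef (fun P : coef_space F nb mb g => forall z : C,
    (d <= \rank (eval_mx iota (block_mat hp hq hn hsn hm hsm P) z))%N)
  <-> (d <= minn n m)%N /\
      (~ (d = n /\ n = m) \/ (forall i j, g i j = 0%N)).
Proof.
move=> hnb0 hmb0; have := full_family_genericP d iota block_mat_full_family.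
rewrite (boolp.propext (block_deg_eq0 hnb0 hmb0)) => <-.
apply: generic_ext => x; split=> [[P [hP <-]] z|hx]; first by rewrite listingK.
by exists (unlisting x); split=> //; exact: unlistingK.
Qed.

End BlockFamily.

(** Both cases concern an embedding into the algebraically closed field [R[i]]: the inclusion of the
    reals and the identity. *)
Theorem proposition3p14 (R : realType) (n m p q d : nat)
    (hn0 : (0 < n)%N) (hm0 : (0 < m)%N) (hp : (0 < p)%N) (hq : (0 < q)%N)
    (nb mb g : 'I_p -> 'I_q -> nat)
    (hnb0 : forall i j, (0 < nb i j)%N) (hmb0 : forall i j, (0 < mb i j)%N)
    (hn : forall i j k, nb i j = nb i k)
    (hsn : forall k, (\sum_i nb i k)%N = n)
    (hm : forall i j k, mb i k = mb j k)
    (hsm : forall j, (\sum_k mb j k)%N = m) :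
  let claim (F : fieldType) (iota : {rmorphism F -> R[i]}) :=
    generic_coef (fun P : coef_space F nb mb g =>
      forall z : R[i],
        (d <= \rank (eval_mx iota (block_mat hp hq hn hsn hm hsm P) z))%N)
    <->
    (d <= minn n m)%N /\
    (~ (d = n /\ n = m) \/ (forall i j, g i j = 0%N)) in
  claim R (real_complex R) /\ claim R[i] idfun.
Proof. by split; apply: generic_block_rankP. Qed.
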